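(* For all $v\in(0,1)$ and $x\in\mathbb{N}_0$, $$E_x\big[v^{\tau_{-1}^-};\tau_{-1}^-<\infty\big]=Z_v(x)-\frac{\varphi_v(1-v)}{v(1-\varphi_v)}W_v(x).$$
   Context: Notation: $\mathbb{N}=\{1,2,\dots\}$, $\mathbb{N}_0=\{0,1,2,\dots\}$; $E[Y;A]:=E[Y\mathbf{1}_A]$; $\inf\emptyset=\infty$. Let $(p_k)_{k\in\mathbb{N}_0}$ be a probability mass function on $\mathbb{N}_0$ with $p_0>0$, and let $C_1,C_2,\dots$ be i.i.d. with $P(C_1=k)=p_k$. Let $X_n=X_0+n-\sum_{i=1}^nC_i$, $n\in\mathbb{N}_0$; for $x\in\mathbb{Z}$, $P_x$ (expectation $E_x$) is the law under which $X_0=x$, and $P=P_0$, $E=E_0$. For $b\in\mathbb{Z}$ let $\tau_b^-=\inf\{n\in\mathbb{N}_0:X_n\le b\}$ and $\tau_b^+=\inf\{n\in\mathbb{N}_0:X_n\ge b\}$. For $v\in(0,1]$: $\varphi_v:=E[v^{\tau_1^+};\tau_1^+<\infty]$; $W_v(y):=\big(p_0E[v^{\tau_y^+};\tau_y^+<\tau_{-1}^-]\big)^{-1}$ for $y\in\mathbb{N}_0$, and $W_v(y):=0$ for integers $y<0$; and, for $x\in\mathbb{N}_0$, $Z_v(x)=1+\left(\frac1v-1\right)\sum_{y=0}^{x-1}W_v(y)$. *)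

(* Defs.v *)
From HB Require Import structures.
From mathcomp Require Import all_boot all_order all_algebra.
From mathcomp Require Import all_classical all_reals all_analysis.

Set Implicit Arguments.
Unset Strict Implicit.
Unset Printing Implicit Defensive.

Import Order.TTheory GRing.Theory Num.Theory.

Local Open Scope classical_set_scope.
Local Open Scope ring_scope.

Definition is_pmf (R : realType) (p : nat -> R) : Prop :=
  (forall k, 0 <= p k) /\ (\sum_(0 <= k <oo) (p k)%:E = 1)%E.

(* Every subset of nat is measurable, so the sets [B i] are arbitrary. *)
Definition mutually_independent (d : measure_display) (T : measurableType d)
    (R : realType) (P : probability T R) (C : nat -> T -> nat) : Prop :=
  forall (J : seq nat) (B : nat -> set nat), uniq J ->
    P (\bigcap_(i in [set` J]) (C i @^-1` B i)) =
    (\prod_(i <- J) P (C i @^-1` B i))%E.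

Definition iid_with_pmf (d : measure_display) (T : measurableType d)
    (R : realType) (P : probability T R) (C : nat -> T -> nat) (p : nat -> R)
    : Prop :=
  mutually_independent P C /\
  (forall i k, P (C i @^-1` [set k]) = (p k)%:E).

(* [P x] is the law under which the walk starts at [x]. The step written C_n
   (n >= 1) is [C n.-1] here. As [int] carries no sigma-algebra in the library,
   measurability of [X0] is spelled out on singletons. *)
Definition walk_laws (d : measure_display) (T : measurableType d)
    (R : realType) (p : nat -> R) (P : int -> probability T R)
    (X0 : T -> int) (C : nat -> {mfun T >-> nat}) : Prop :=
  [/\ forall k : int, measurable (X0 @^-1` [set k]),
      forall x : int, P x (X0 @^-1` [set x]) = 1%E
    & forall x : int, iid_with_pmf (P x) (fun i => C i : T -> nat) p].

Section Walk.
Context {d : measure_display} {T : measurableType d} {R : realType}.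

Definition walk (X0 : T -> int) (C : nat -> T -> nat) (n : nat) (w : T) : int :=
  X0 w + n%:Z - (\sum_(i < n) C i w)%N%:Z.

(* The convention inf set0 = +oo is the one of [ereal_inf]. *)
Definition tau_down (X0 : T -> int) (C : nat -> T -> nat) (b : int) (w : T)
    : \bar R :=
  ereal_inf [set n%:R%:E | n in [set n : nat | walk X0 C n w <= b]].

Definition tau_up (X0 : T -> int) (C : nat -> T -> nat) (b : int) (w : T)
    : \bar R :=
  ereal_inf [set n%:R%:E | n in [set n : nat | walk X0 C n w >= b]].

(* E[v^tau; A]; only used for events A contained in {tau < +oo}, where
   [fine tau] is the value of tau. *)
Definition discounted (P : probability T R) (v : R) (tau : T -> \bar R)
    (A : set T) : \bar R :=
  ('E_P[fun w => (v `^ fine (tau w) * \1_A w)%R])%E.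

Definition phi (P : int -> probability T R) (X0 : T -> int)
    (C : nat -> T -> nat) (v : R) : R :=
  fine (discounted (P 0) v (tau_up X0 C 1)
          [set w | (tau_up X0 C 1 w < +oo)%E]).

Definition W (p : nat -> R) (P : int -> probability T R) (X0 : T -> int)
    (C : nat -> T -> nat) (v : R) (y : int) : R :=
  if 0 <= y then
    (p 0%N * fine (discounted (P 0) v (tau_up X0 C y)
       [set w | (tau_up X0 C y w < tau_down X0 C (- 1) w)%E]))^-1
  else 0.

Definition Z (p : nat -> R) (P : int -> probability T R) (X0 : T -> int)
    (C : nat -> T -> nat) (v : R) (x : nat) : R :=
  1 + (v^-1 - 1) * \sum_(y < x) W p P X0 C v y%:Z.

End Walk.

(* Main.v *)
Require Import Defs.
From HB Require Import structures.
From mathcomp Require Import all_boot all_order all_algebra.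
From mathcomp Require Import all_classical all_reals all_analysis.
From mathcomp Require Import measurable_realfun.
From mathcomp Require Import ring lra zify.

Import Order.TTheory GRing.Theory Num.Theory.

Local Open Scope classical_set_scope.
Local Open Scope ring_scope.

(** The three discounted expectations in the statement (the one on the left, the
    one in [W] and the one in [phi]) are instances of a single function
    u(z) = E_z[v^tau_A; tau_A < tau_B], for disjoint sets A and B. It is the
    series of the v^n q_n(z), where q_n(z) is the probability that the walk from
    z enters A at time n without having met A or B before
    ([discounted_series]). Conditioning on the first step gives
    u(z) = v sum_k p_k u(z + 1 - k) off A and B ([exit_value_step]), and nothing
    more about the walk is needed: the strong Markov property is replaced by
    uniqueness for this linear recursion.

    Scale function. If u vanishes below 0, the sum over k is finite because the
    walk climbs by at most one, so the equation at x is F x = v (p * F)(x + 1)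
    with a convolution on the natural numbers, and p_0 > 0 makes it determine
    F (x + 1) from earlier values. Solutions are thus proportional; comparing the
    two-sided exit functions with upper levels y and a >= y shows that
    W y = u_a(y) W a, so W itself solves the equation ([scale_convol]). Summing
    it, H = - (1/v - 1) sum_(y < x) W y solves the inhomogeneous equation
    H x = (1 - v) + v (p * H)(x + 1) ([sum_convol]).

    First ascent. The numbers h(j) = E_0[v^tau_j^+] satisfy the dual recursion
    h(j + 1) = v sum_k p_k h(j + k), whose bounded solutions are determined by
    their value at 0 because v < 1 makes it a contraction. Hence h(j) = phi^j,
    and phi = v sum_k p_k phi^k ([dual_harmonic_exp], [ascent_exp]).

    Conclusion. The function g(x) = 1 - E_x[v^tau_(-1)^-] also solves the
    inhomogeneous equation, so g - H is a multiple of W, and only g(0) remains to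
    be found. As g is bounded, its generating function may be evaluated at
    s = phi; there s = v sum_k p_k s^k makes the unknown series cancel, leaving
    v p_0 g(0) = (1 - v) phi / (1 - phi) ([survival_at0]). This is the
    coefficient in the statement, since W 0 = 1 / p_0. *)

(** * Law of the first entrance of the walk *)

Section ExitLaw.
Context {d : measure_display} {T : measurableType d} {R : realType}.
Context (C : nat -> T -> nat) (p : nat -> R) (A B : pred int).

(** With [m] steps already made and current position [z], the event that the walk
    enters [A] after exactly [n] further steps and meets neither [A] nor [B]
    earlier. The position is a parameter, rather than read off [X0], so that the
    next step splits the event into a countable disjoint union. *)
Fixpoint exit_event (m n : nat) (z : int) : set T :=
  if n is n'.+1 then
    if A z || B z then set0
    else \bigcup_k (C m @^-1` [set k] `&` exit_event m.+1 n' (z + 1 - k%:Z))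
  else if A z then setT else set0.

Fixpoint exit_prob (n : nat) (z : int) : \bar R :=
  if n is n'.+1 then
    if A z || B z then 0%E
    else (\sum_(0 <= k <oo) (p k)%:E * exit_prob n' (z + 1 - k%:Z))%E
  else if A z then 1%E else 0%E.

Lemma exit_prob_ge0 n z : (forall k, 0 <= p k) -> (0 <= exit_prob n z)%E.
Proof.
move=> p0; elim: n z => [|n IH] z /=; first by case: ifP.
case: ifP => // _; apply: nneseries_ge0 => k _ _.
by rewrite mule_ge0 ?lee_fin.
Qed.

Lemma exit_event_walk (X0 : T -> int) m n w :
  exit_event m n (walk X0 C m w) w <->
  (forall j, (j < n)%N -> ~~ (A (walk X0 C (m + j) w) || B (walk X0 C (m + j) w)))
  /\ A (walk X0 C (m + n) w).
Proof.
elim: n m => [|n IH] m /=.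
  by rewrite addn0; case: (A _) => /=; split => // -[].
have step : walk X0 C m w + 1 - (C m w)%:Z = walk X0 C m.+1 w.
  by rewrite /walk big_ord_recr /= PoszD -(addn1 m) PoszD; lia.
case: ifPn => [D|nD].
  by split => // -[/(_ 0%N isT)]; rewrite addn0 D.
split.
  move=> [k _ /= [<-]]; rewrite step => /IH[H1 H2].
  split; last by rewrite -addSnnS.
  by case=> [|j] jn; [rewrite addn0|rewrite -addSnnS; exact: H1].
move=> [H1 H2]; exists (C m w) => //=; split=> //; rewrite step; apply/IH.
by split=> [j jn|]; rewrite addSnnS //; exact: H1.
Qed.

Lemma measurable_exit_event m n z :
  (forall i k, measurable (C i @^-1` [set k])) -> measurable (exit_event m n z).
Proof.
move=> mC; elim: n m z => [|n IH] m z /=; first by case: ifP.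
case: ifP => // _; apply: bigcup_measurable => k _.
by apply: measurableI; [exact: mC|exact: IH].
Qed.

(** The induction on [n] conditions on one more step, so the statement has to carry
    the steps already fixed: on the cylinder {C_i = c i for i < m} the remaining
    steps are still fresh, which is where independence enters. *)
Lemma exit_event_law (Q : probability T R) m n z (c : nat -> nat) :
  (forall i k, measurable (C i @^-1` [set k])) ->
  (forall k, 0 <= p k) -> iid_with_pmf Q C p ->
  Q ([set w | forall i, (i < m)%N -> C i w = c i] `&` exit_event m n z) =
  ((\prod_(i < m) p (c i))%:E * exit_prob n z)%E.
Proof.
move=> mC p0 [indep law].
(* Independence is used only here, for cylinders. *)
have cyl k (c' : nat -> nat) :
    Q [set w | forall i, (i < k)%N -> C i w = c' i] = (\prod_(i < k) p (c' i))%:E.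
  have := indep (iota 0 k) (fun i => [set c' i]) (iota_uniq _ _).
  rewrite (_ : \bigcap_(i in _) _ = [set w | forall i, (i < k)%N -> C i w = c' i]).
    move=> ->; rewrite -[X in iota 0 X]subn0 -/(index_iota 0 k) big_mkord.
    by rewrite -prodEFin; apply: eq_bigr => i _; rewrite law.
  apply/seteqP; split => w /= H i.
    by move=> ik; apply: H => /=; rewrite mem_iota.
  by rewrite /= mem_iota /=; exact: H.
have mcyl k (c' : nat -> nat) : measurable [set w | forall i, (i < k)%N -> C i w = c' i].
  rewrite (_ : mkset _ = \bigcap_(i in [set j | (j < k)%N]) (C i @^-1` [set c' i])) //.
  by apply: bigcap_measurableType => i _; exact: mC.
elim: n m z c => [|n IH] m z c /=.
  case: ifP => _; first by rewrite setIT cyl mule1.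
  by rewrite setI0 measure0 mule0.
case: ifP => _; first by rewrite setI0 measure0 mule0.
rewrite setI_bigcupr measure_bigcup; last 2 first.
- move=> k _; apply: measurableI => //; apply: measurableI => //.
  exact: measurable_exit_event.
- by move=> i j _ _ [w /= [[_ [<- _]]] [_ [<- _]]].
rewrite -nneseriesZl; last first.
  by move=> k _; rewrite mule_ge0 ?lee_fin ?exit_prob_ge0.
under eq_eseriesl do rewrite in_setT.
apply: eq_eseriesr => k _.
(* Fixing the step C_m = k turns the cylinder of length m into one of length
   m + 1, for [c] modified at m. *)
rewrite [X in Q X = _](_ : _ =
    [set w | forall i, (i < m.+1)%N -> C i w = if i == m then k else c i]
    `&` exit_event m.+1 n (z + 1 - k%:Z)); last first.
  apply/seteqP; split => w /=.
    move=> [H [H1 H2]]; split=> // i; rewrite ltnS leq_eqVlt.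
    by case: eqVneq => [-> //|_ /=]; exact: H.
  move=> [H H2]; split; last first.
    by split=> //; rewrite (H m (ltnSn m)) eqxx.
  move=> i im; rewrite (H i (ltnW im)).
  by case: eqVneq => // e; rewrite e ltnn in im.
rewrite IH big_ord_recr /= eqxx EFinM -muleA; congr ((_)%:E * _)%E.
by apply: eq_bigr => i _; rewrite ltn_eqF.
Qed.

End ExitLaw.

(** * Discounted expectations as series *)

Section Discount.
Context {d : measure_display} {T : measurableType d} {R : realType}.

(** Common form of [tau_down] and [tau_up], and, for [A := pred0], of the constant
    +oo; the latter lets the event {tau < +oo} be treated as {tau_A < tau_B}. *)
Definition hitting_time (X0 : T -> int) (C : nat -> T -> nat) (A : pred int)
    (w : T) : \bar R :=
  ereal_inf [set n%:R%:E | n in [set n : nat | A (walk X0 C n w)]].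

Lemma hitting_time_first (X0 : T -> int) (C : nat -> T -> nat) (A : pred int) w n :
  A (walk X0 C n w) -> (forall j, (j < n)%N -> ~~ A (walk X0 C j w)) ->
  hitting_time X0 C A w = n%:R%:E.
Proof.
move=> An nA; apply/le_anti/andP; split; first by apply: ereal_inf_lbound; exists n.
apply: le_ereal_inf_tmp => _ [j /= Aj <-]; rewrite lee_fin ler_nat leqNgt.
by apply/negP => /nA; rewrite Aj.
Qed.

Lemma hitting_timeP (X0 : T -> int) (C : nat -> T -> nat) (A : pred int) w :
  (exists n, [/\ A (walk X0 C n w), forall j, (j < n)%N -> ~~ A (walk X0 C j w)
     & hitting_time X0 C A w = n%:R%:E]) \/
  (forall n, ~~ A (walk X0 C n w)) /\ hitting_time X0 C A w = +oo%E.
Proof.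
have [exA|nA] := pselect (exists n, A (walk X0 C n w)).
  left; case: (ex_minnP exA) => m Am mmin; exists m.
  have nA j : (j < m)%N -> ~~ A (walk X0 C j w).
    by move=> jm; apply/negP => /mmin; rewrite leqNgt jm.
  by split=> //; exact: hitting_time_first.
have {}nA n : ~~ A (walk X0 C n w) by apply/negP => An; apply: nA; exists n.
right; split=> //; rewrite /hitting_time (_ : mkset _ = set0) ?image_set0 ?ereal_inf0 //.
by apply/seteqP; split => n //= An; have := nA n; rewrite An.
Qed.

Definition exit_at (X0 : T -> int) (C : nat -> T -> nat) (A B : pred int)
  (n : nat) : set T := [set w | exit_event C A B 0 n (X0 w) w].

Lemma exit_atP (X0 : T -> int) (C : nat -> T -> nat) (A B : pred int) n w :
  exit_at X0 C A B n w <->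
  (forall j, (j < n)%N -> ~~ (A (walk X0 C j w) || B (walk X0 C j w)))
  /\ A (walk X0 C n w).
Proof.
have := exit_event_walk C A B X0 0 n w.
by rewrite {1}/walk big_ord0 addr0 subr0.
Qed.

Lemma exit_at_hitting (X0 : T -> int) (C : nat -> T -> nat) (A B : pred int) n w :
  (forall z, A z -> ~~ B z) ->
  exit_at X0 C A B n w <->
  hitting_time X0 C A w = n%:R%:E /\
  (hitting_time X0 C A w < hitting_time X0 C B w)%E.
Proof.
move=> AB; split.
  move=> /exit_atP[H An].
  have tA : hitting_time X0 C A w = n%:R%:E.
    by apply: hitting_time_first => // j /H; rewrite negb_or => /andP[].
  split=> //; rewrite tA.
  case: (hitting_timeP X0 C B w) => [[m [Bm _ ->]]|[_ ->]]; last exact: ltry.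
  rewrite lte_fin ltr_nat; case: ltngtP => // [mn|e].
    by have := H _ mn; rewrite Bm orbT.
  by have := AB _ An; rewrite e Bm.
move=> [tA lt]; case: (hitting_timeP X0 C A w) => [[m [Am nA tA']]|[_ tA']]; last first.
  by rewrite tA' in tA.
have e : m = n by move: tA; rewrite tA' => -[/eqP]; rewrite eqr_nat => /eqP.
move: Am nA; rewrite e => Am nA.
apply/exit_atP; split=> // j jn; rewrite negb_or nA //=.
apply/negP => Bj; move: lt; rewrite tA ltNge => /negP; apply.
apply: (@le_trans _ _ (j%:R%:E)); last by rewrite lee_fin ler_nat ltnW.
by apply: ereal_inf_lbound; exists j.
Qed.

(** As [X0] is only known to be measurable on singletons, the event is split along
    the countably many values of [X0]. *)
Lemma measurable_exit_at (X0 : T -> int) (C : nat -> T -> nat) (A B : pred int) n :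
  (forall k : int, measurable (X0 @^-1` [set k])) ->
  (forall i k, measurable (C i @^-1` [set k])) ->
  measurable (exit_at X0 C A B n).
Proof.
move=> mX mC.
rewrite (_ : exit_at X0 C A B n =
   \bigcup_(z : int) (X0 @^-1` [set z] `&` exit_event C A B 0 n z)).
  apply: countable_bigcupT_measurable => // z.
  by apply: measurableI => //; exact: measurable_exit_event.
apply/seteqP; split => w /=; first by move=> H; exists (X0 w).
by move=> [z _ /= [<-]].
Qed.

Lemma measure_setI_full (Q : probability T R) (E F : set T) :
  measurable E -> measurable F -> Q F = 1%E -> Q (E `&` F) = Q E.
Proof.
move=> mE mF QF; rewrite (measureDI Q mE mF).
rewrite [X in _ = (X + _)%E](_ : _ = 0%E) ?add0e//.
apply/eqP; rewrite eq_le measure_ge0 andbT.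
have <- : Q (~` F) = 0%E by rewrite probability_setC// QF subee.
apply: le_measure; rewrite ?inE; [exact: measurableD|exact: measurableC|].
by move=> w [].
Qed.

(** The event [exit_at] starts from the random position [X0], the event
    [exit_event] from the fixed [x]; they agree on the almost sure event
    {X0 = x}. *)
Lemma exit_at_law (Q : probability T R) (X0 : T -> int)
    (C : nat -> T -> nat) (p : nat -> R) (A B : pred int) n x :
  (forall k : int, measurable (X0 @^-1` [set k])) ->
  (forall i k, measurable (C i @^-1` [set k])) ->
  (forall k, 0 <= p k) -> iid_with_pmf Q C p -> Q (X0 @^-1` [set x]) = 1%E ->
  Q (exit_at X0 C A B n) = exit_prob p A B n x.
Proof.
move=> mX mC p0 iid Qx.
rewrite -(measure_setI_full _ _ _ (measurable_exit_at _ _ _ _ _ mX mC) (mX x) Qx).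
rewrite (_ : _ `&` _ = exit_event C A B 0 n x `&` X0 @^-1` [set x]).
  rewrite (measure_setI_full _ _ _ (measurable_exit_event _ _ _ _ _ _ mC) (mX x) Qx).
  have := exit_event_law C p A B Q 0 n x id mC p0 iid.
  rewrite big_ord0 mul1e => <-; congr (Q _).
  by apply/seteqP; split=> w //= [].
by apply/seteqP; split=> w /= [+ e]; rewrite /exit_at /= e.
Qed.

(** The events [exit_at n] are disjoint, cover {tau_A < tau_B}, and tau_A = n on the
    n-th one, so the integrand is the sum of the v^n 1_(exit_at n). *)
Lemma discounted_series (Q : probability T R) (X0 : T -> int)
    (C : nat -> T -> nat) (p : nat -> R) (A B : pred int) x (v : R) :
  (forall k : int, measurable (X0 @^-1` [set k])) ->
  (forall i k, measurable (C i @^-1` [set k])) ->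
  (forall k, 0 <= p k) -> iid_with_pmf Q C p -> Q (X0 @^-1` [set x]) = 1%E ->
  (forall z, A z -> ~~ B z) -> 0 <= v ->
  discounted Q v (hitting_time X0 C A)
    [set w | (hitting_time X0 C A w < hitting_time X0 C B w)%E] =
  (\sum_(0 <= n <oo) (v ^+ n)%:E * exit_prob p A B n x)%E.
Proof.
move=> mX mC p0 iid Qx AB v0; rewrite /discounted unlock.
have mE n : measurable (exit_at X0 C A B n) by exact: measurable_exit_at.
transitivity (\int[Q]_w (\sum_(0 <= n <oo)
    (v ^+ n)%:E * (\1_(exit_at X0 C A B n) w)%:E))%E.
  apply: eq_integral => w _; rewrite indicE.
  have [|nlt] := boolP (w \in _); last first.
    rewrite mulr0 eseries0 // => n _ _; rewrite indicE.
    case: (boolP (w \in exit_at _ _ _ _ _)); last by rewrite mule0.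
    by rewrite inE => /exit_at_hitting-/(_ AB)[_ H]; rewrite mem_set in nlt.
  rewrite inE /= => lt.
  case: (hitting_timeP X0 C A w) => [[n [An nA tA]]|[_ tA]]; last first.
    by rewrite tA in lt; move: lt; rewrite ltNge leey.
  rewrite (nneseriesD1 (n := n)) //; last first.
    by move=> k _; rewrite -EFinM lee_fin mulr_ge0 // exprn_ge0.
  rewrite eseries0 ?adde0 => [|k _ /= kn].
    rewrite tA /= powR_mulrn // indicE mem_set ?EFinM//.
    by apply/exit_at_hitting.
  rewrite indicE memNset ?mule0 // => /exit_at_hitting-/(_ AB)[+ _].
  by rewrite tA => -[/eqP]; rewrite eqr_nat eq_sym (negbTE kn).
rewrite integral_nneseries //=; last 2 first.
- move=> n; apply/measurable_EFinP; apply: measurable_funM => //.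
- by move=> n w _; rewrite -EFinM lee_fin mulr_ge0 // exprn_ge0.
apply: eq_eseriesr => n _.
rewrite ge0_integralZl_EFin //; last 2 first.
- by apply/measurable_EFinP.
- exact: exprn_ge0.
by rewrite integral_indic // setIT; congr (_ * _)%E; exact: exit_at_law.
Qed.

End Discount.

(** * First-step equation *)

Section FirstStep.
Context {R : realType} (p : nat -> R) (hp : is_pmf p) (v : R).
Context (hv : 0 < v < 1) (A B : pred int).

(** E_z[v^tau_A; tau_A < tau_B], in the form given by [discounted_series]. *)
Definition exit_value (z : int) : \bar R :=
  (\sum_(0 <= n <oo) (v ^+ n)%:E * exit_prob p A B n z)%E.

Let p0 : forall k, 0 <= p k. Proof. by case: hp. Qed.
Let v0 : 0 <= v. Proof. by case/andP: hv => /ltW. Qed.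

Lemma exit_term_ge0 n z : (0 <= (v ^+ n)%:E * exit_prob p A B n z)%E.
Proof. by rewrite mule_ge0 ?lee_fin ?exprn_ge0 ?exit_prob_ge0. Qed.

Lemma exit_value_ge0 z : (0 <= exit_value z)%E.
Proof. by apply: nneseries_ge0 => n _ _; exact: exit_term_ge0. Qed.

Lemma exit_value_recl z : exit_value z =
  (exit_prob p A B 0 z + \sum_(0 <= n <oo) (v ^+ n.+1)%:E * exit_prob p A B n.+1 z)%E.
Proof.
rewrite /exit_value nneseries_recl //; last by move=> n _; exact: exit_term_ge0.
rewrite expr0 mul1e; congr (_ + _)%E.
rewrite -(nneseries_addn 1); last by move=> n; exact: exit_term_ge0.
by apply: eq_eseriesr => n _; rewrite addn1.
Qed.

Lemma exit_value_target z : A z -> exit_value z = 1%E.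
Proof.
move=> Az; rewrite exit_value_recl /= Az eseries0 ?adde0 // => n _ _.
by rewrite mule0.
Qed.

Lemma exit_value_killed z : ~~ A z -> B z -> exit_value z = 0%E.
Proof.
move=> Az Bz; rewrite exit_value_recl /= (negbTE Az) Bz eseries0 ?adde0 // => n _ _.
by rewrite mule0.
Qed.

Lemma exit_value_step z : ~~ A z -> ~~ B z -> exit_value z =
  (v%:E * \sum_(0 <= k <oo) (p k)%:E * exit_value (z + 1 - k%:Z)%R)%E.
Proof.
move=> /negbTE Az /negbTE Bz; rewrite exit_value_recl /= Az Bz add0e /=.
have nn i j : (0 <= (v ^+ i.+1)%:E * ((p j)%:E * exit_prob p A B i (z + 1 - j%:Z)%R))%E.
  by rewrite !mule_ge0 ?lee_fin ?exprn_ge0 ?exit_prob_ge0.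
under eq_eseriesr => n _.
  rewrite -nneseriesZl; last by move=> k _; rewrite mule_ge0 ?lee_fin ?exit_prob_ge0.
  over.
rewrite nneseries_interchange // -nneseriesZl; last first.
  by move=> k _; rewrite mule_ge0 ?lee_fin ?exit_value_ge0.
apply: eq_eseriesr => k _; rewrite muleA -EFinM /exit_value -nneseriesZl; last first.
  by move=> n _; exact: exit_term_ge0.
apply: eq_eseriesr => n _; rewrite !muleA -!EFinM; congr (_%:E * _)%E.
by rewrite exprS; ring.
Qed.

(** Induction on the partial sums: by the first-step equation a bound 1 for the
    first N terms at every starting point gives the bound v for N + 1 terms off
    [A] and [B]. *)
Lemma exit_value_le1 z : (exit_value z <= 1)%E.
Proof.
apply: lime_le; first by apply: is_cvg_nneseries => n _ _; exact: exit_term_ge0.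
apply: nearW => N; elim: N z => [|N IH] z; first by rewrite big_geq.
rewrite big_nat_recl //= expr0 mul1e.
have [Az|Az] := boolP (A z).
  by rewrite big1 ?adde0 //= => n _; rewrite mule0.
have [Bz|Bz] /= := boolP (B z).
  by rewrite big1 ?adde0 //= => n _; rewrite mule0.
rewrite add0e.
have nn i j : (0 <= (v ^+ i.+1)%:E * ((p j)%:E * exit_prob p A B i (z + 1 - j%:Z)%R))%E.
  by rewrite !mule_ge0 ?lee_fin ?exprn_ge0 ?exit_prob_ge0.
under eq_bigr => n _.
  rewrite -nneseriesZl; last by move=> k _; rewrite mule_ge0 ?lee_fin ?exit_prob_ge0.
  over.
rewrite -nneseries_sum_nat // -hp.2.
apply: lee_nneseries => [k _ _|k _]; first by apply: sume_ge0.
rewrite -[leRHS]mule1.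
apply: (@le_trans _ _ ((p k)%:E * \sum_(0 <= n < N)
    (v ^+ n)%:E * exit_prob p A B n (z + 1 - k%:Z)%R)%E); last first.
  by apply: lee_wpmul2l; rewrite ?lee_fin.
rewrite ge0_sume_distrr; last by move=> n _; exact: exit_term_ge0.
apply: lee_sum => n _; rewrite !muleA -!EFinM.
apply: lee_wpmul2r; first exact: exit_prob_ge0.
rewrite lee_fin mulrC ler_wpM2l // exprS ler_piMl ?exprn_ge0 //.
by case/andP: hv => _ /ltW.
Qed.

Lemma fine_exit_valueK z : (fine (exit_value z))%:E = exit_value z.
Proof.
apply: fineK; rewrite ge0_fin_numE ?exit_value_ge0 //.
exact: le_lt_trans (exit_value_le1 z) (ltry _).
Qed.

Lemma fine_exit_value_itv z : 0 <= fine (exit_value z) <= 1.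
Proof.
by rewrite -!lee_fin fine_exit_valueK exit_value_ge0 exit_value_le1.
Qed.

End FirstStep.

(** * The convolution equation and the scale function *)

Section Convolution.
Context {R : realType} (p : nat -> R) (v : R).

Definition convol (F : nat -> R) (n : nat) : R :=
  \sum_(k < n.+1) p k * F (n - k)%N.

Lemma convolS F n : convol F n.+1 = p 0%N * F n.+1 + \sum_(k < n.+1) p k.+1 * F (n - k)%N.
Proof.
by rewrite /convol big_ord_recl subn0; congr (_ + _); apply: eq_bigr.
Qed.

Lemma convol_linear a b F G n :
  convol (fun x => a * F x + b * G x) n = a * convol F n + b * convol G n.
Proof.
rewrite /convol !mulr_sumr -big_split /=; apply: eq_bigr => k _; ring.
Qed.

(** The equation at x contains the value at x + 1 with the factor v p_0, and
    otherwise only values at points up to x. *)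
Lemma convol_eq0 (F : nat -> R) a : p 0%N != 0 -> v != 0 -> F 0%N = 0 ->
  (forall x, (x < a)%N -> F x = v * convol F x.+1) ->
  forall y, (y <= a)%N -> F y = 0.
Proof.
move=> p0 v0 F0 FE; elim/ltn_ind => -[//|y] IH ya.
have := FE y ya; rewrite IH ?(ltnW ya) // convolS big1 ?addr0.
  by move/esym/eqP; rewrite !mulf_eq0 (negbTE p0) (negbTE v0) => /eqP.
move=> k _; rewrite IH ?mulr0 //; first by rewrite ltnS leq_subr.
by apply: leq_trans (leq_subr _ _) (ltnW ya).
Qed.

(** The terms with k > n vanish: a step by - k from n leads below 0. This turns the
    infinite first-step sum into a finite one. *)
Lemma series_convol (G : int -> \bar R) (F : nat -> R) n :
  (forall k, 0 <= p k) -> (forall z, (0 <= G z)%E) ->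
  (forall z, z < 0 -> G z = 0%E) -> (forall i : nat, G i%:Z = (F i)%:E) ->
  (\sum_(0 <= k <oo) (p k)%:E * G (n%:Z - k%:Z)%R = (convol F n)%:E)%E.
Proof.
move=> p0 G0 Gneg GF; rewrite (nneseries_split 0 n.+1); last first.
  by move=> k _; rewrite mule_ge0 ?lee_fin.
rewrite eseries0 ?adde0 => [|k]; last first.
  by rewrite add0n => nk _; rewrite Gneg ?mule0 //; lia.
rewrite add0n big_mkord /convol -sumEFin; apply: eq_bigr => k _.
have kn : (k <= n)%N by rewrite -ltnS.
by rewrite subzn // GF EFinM.
Qed.

(** [U a x] stands for E_x[v^tau_a^+; tau_a^+ < tau_(-1)^-]. *)
Section Scale.
Context (p0 : p 0%N != 0) (v0 : v != 0) (U : nat -> nat -> R).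
Context (U1 : forall a, U a a = 1).
Context (UE : forall a x, (x < a)%N -> U a x = v * convol (U a) x.+1).

Definition scale (y : nat) : R := (p 0%N * U y 0%N)^-1.

Lemma U0_neq0 a : U a 0%N != 0.
Proof.
apply/eqP => Ua0; have := convol_eq0 (U a) a p0 v0 Ua0 (UE a) a (leqnn a).
by rewrite U1 => /eqP; rewrite oner_eq0.
Qed.

(** Up to level [y] both [U a] and [U y] solve the homogeneous equation, so they are
    proportional; their ratio is read off at 0 and at [y]. In probabilistic terms
    this is U_a(0) = U_y(0) U_a(y), the strong Markov property at tau_y^+. *)
Lemma U_scale a y : (y <= a)%N -> scale y = U a y * scale a.
Proof.
move=> ya.
have : U y 0%N * U a y + (- U a 0%N) * U y y = 0.
  apply: (convol_eq0 (fun z => U y 0%N * U a z + (- U a 0%N) * U y z) y) => //.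
    by ring.
  move=> x xy; rewrite convol_linear (UE a x) ?(leq_trans xy) // (UE y x) //; ring.
rewrite U1 /scale => E; have := U0_neq0 a; have := U0_neq0 y => h1 h2.
have -> : U a y = U a 0%N / U y 0%N by apply: (mulfI h1); rewrite mulrCA divff //; lra.
by field; rewrite p0 h1 h2.
Qed.

Lemma scale0 : scale 0 = (p 0%N)^-1.
Proof. by rewrite /scale U1 mulr1. Qed.

Lemma scale_convol x : scale x = v * convol scale x.+1.
Proof.
rewrite (U_scale x.+1) // UE // -mulrA; congr (_ * _).
rewrite /convol mulr_suml; apply: eq_bigr => k _.
by rewrite [in RHS](U_scale x.+1) ?leq_subr // mulrA.
Qed.

End Scale.

(** The increment of the sum at [x] is [Wn x], which solves the homogeneous
    equation, so the difference between S x and v (p * S)(x + 1), for S the sum,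
    does not depend on [x]; at 0 it is - v p_0 (Wn 0) = - v. *)
Lemma sum_convol (Wn : nat -> R) x : p 0%N != 0 -> Wn 0%N = (p 0%N)^-1 ->
  (forall x, Wn x = v * convol Wn x.+1) ->
  \sum_(y < x) Wn y = v * convol (fun x => \sum_(y < x) Wn y) x.+1 - v.
Proof.
move=> p0 W0 WE.
pose S x := \sum_(y < x) Wn y; rewrite -/(S x) -/S.
have SS n : convol S n.+1 = convol S n + convol Wn n.
  rewrite /convol big_ord_recr /= subnn {2}/S big_ord0 mulr0 addr0 -big_split /=.
  apply: eq_bigr => k _; rewrite subSn -1?ltnS // /S big_ord_recr /=; ring.
elim: x => [|x IH].
  rewrite SS /convol !big_ord_recl !big_ord0 /= /S !big_ord0 W0.
  by field.
by rewrite SS /S big_ord_recr /= -/(S x) IH {1}WE; ring.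
Qed.

End Convolution.

(** * Generating functions *)

Section GeneratingFunction.
Context {R : realType}.

Lemma geometric_eseries (s : R) : 0 <= s < 1 ->
  (\sum_(0 <= n <oo) (s ^+ n)%:E)%E = ((1 - s)^-1)%:E.
Proof.
move=> /andP[s0 s1]; apply/cvg_lim => //.
have -> : (fun n => (\sum_(0 <= i < n) (s ^+ i)%:E)%E) = EFin \o series (geometric 1 s).
  apply/funext => n /=; rewrite sumEFin /series /=; congr EFin.
  by apply: eq_bigr => i _; rewrite mul1r.
apply: cvg_EFin; first exact: nearW.
rewrite -[(1 - s)^-1]mul1r; apply: cvg_geometric_series.
by rewrite ger0_norm.
Qed.

(** The Cauchy product, by exchanging the two nonnegative series. *)
Lemma convol_gf (p g : nat -> R) (s a : R) :
  (forall k, 0 <= p k) -> (forall k, 0 <= g k) -> 0 <= s ->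
  (\sum_(0 <= n <oo) (s ^+ n * g n)%:E = a%:E)%E ->
  (\sum_(0 <= n <oo) (s ^+ n * convol p g n)%:E =
   a%:E * \sum_(0 <= k <oo) (p k * s ^+ k)%:E)%E.
Proof.
move=> p0 g0 s0 ga.
(* The convolution term, extended by 0 to all pairs, so that both sums are over
   all natural numbers. *)
pose t k n : \bar R :=
  (if (k <= n)%N then p k * s ^+ k * (s ^+ (n - k) * g (n - k)%N) else 0)%:E.
have t0 k n : (0 <= t k n)%E.
  by rewrite /t lee_fin; case: ifP => // _; rewrite !mulr_ge0 ?exprn_ge0.
transitivity (\sum_(0 <= n <oo) \sum_(0 <= k <oo) t k n)%E.
  apply: eq_eseriesr => n _; rewrite (nneseries_split 0 n.+1) //.
  rewrite [X in (_ + X)%E]eseries0 ?adde0 => [|k kn _]; last first.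
    by rewrite /t leqNgt -ltnS; case: ifP => //; lia.
  rewrite add0n big_mkord sumEFin /convol mulr_sumr; congr EFin.
  apply: eq_bigr => k _; have kn : (k <= n)%N by rewrite -ltnS.
  rewrite kn; have -> : s ^+ n = s ^+ k * s ^+ (n - k) by rewrite -exprD subnKC.
  by ring.
rewrite nneseries_interchange // -nneseriesZl; last first.
  by move=> k _; rewrite lee_fin mulr_ge0 ?exprn_ge0.
apply: eq_eseriesr => k _; rewrite (nneseries_split 0 k) //.
rewrite big_nat_cond big1 ?add0e => [|n]; last first.
  by rewrite add0n andbT /t /= => nk; rewrite leqNgt nk.
rewrite -(nneseries_addn k) // -ga muleC -nneseriesZl; last first.
  by move=> n _; rewrite lee_fin mulr_ge0 ?exprn_ge0.
by apply: eq_eseriesr => n _; rewrite /t leq_addl addnK -EFinM.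
Qed.

(** Multiply the equation at x by s^(x+1) and sum over x. With a = sum_x s^x g(x),
    which is finite because g is bounded, this reads
    s a = (1 - v) s / (1 - s) + v (a G(s) - p_0 g(0)), where G is the generating
    function of [p]. At a point s with v G(s) = s the unknown a cancels. *)
Lemma survival_at0 (p g : nat -> R) (s v : R) :
  (forall k, 0 <= p k) -> (forall k, 0 <= g k <= 1) -> 0 <= s < 1 -> 0 < v < 1 ->
  (\sum_(0 <= k <oo) (p k * s ^+ k)%:E = (s / v)%:E)%E ->
  (forall x, g x = (1 - v) + v * convol p g x.+1) ->
  v * (p 0%N * g 0%N) = (1 - v) * s / (1 - s).
Proof.
move=> p0 g01 /andP[s0 s1] /andP[v0 v1] Gs gE.
have g0 k : 0 <= g k by case/andP: (g01 k).
have c0 n : 0 <= convol p g n by apply: sumr_ge0 => k _; rewrite mulr_ge0.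
have nn n : (0 <= (s ^+ n * g n)%:E)%E by rewrite lee_fin mulr_ge0 ?exprn_ge0.
have [a ga] : exists a, (\sum_(0 <= n <oo) (s ^+ n * g n)%:E = a%:E)%E.
  exists (fine (\sum_(0 <= n <oo) (s ^+ n * g n)%:E)%E).
  rewrite fineK // ge0_fin_numE ?nneseries_ge0 //.
  apply: (@le_lt_trans _ _ (\sum_(0 <= n <oo) (s ^+ n)%:E)%E).
    apply: lee_nneseries => // n _; rewrite lee_fin ler_piMr ?exprn_ge0 //.
    by case/andP: (g01 n).
  by rewrite geometric_eseries ?s0 // ltry.
have := convol_gf p g s a p0 g0 s0 ga.
rewrite Gs nneseries_recl //; last by move=> n _; rewrite lee_fin mulr_ge0 ?exprn_ge0.
rewrite -(nneseries_addn 1); last by move=> n; rewrite lee_fin mulr_ge0 ?exprn_ge0.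
set S := (\sum_(0 <= n <oo) _)%E => E1.
have S0 : (0 <= S)%E.
  by apply: nneseries_ge0 => n _ _; rewrite lee_fin mulr_ge0 ?exprn_ge0.
have E2 : (s%:E * a%:E = ((1 - v) * s)%:E * ((1 - s)^-1)%:E + v%:E * S)%E.
  rewrite -ga -geometric_eseries ?s0 // -!nneseriesZl; last 3 first.
  - by move=> n _; rewrite lee_fin mulr_ge0 ?exprn_ge0.
  - by move=> n _; rewrite lee_fin exprn_ge0.
  - by move=> n _; rewrite //.
  rewrite -nneseriesD; last 2 first.
  - by move=> n _ _; rewrite -EFinM lee_fin !mulr_ge0 ?exprn_ge0 // subr_ge0 ltW.
  - by move=> n _ _; rewrite -EFinM lee_fin !mulr_ge0 ?exprn_ge0 // ltW.
  apply: eq_eseriesr => n _; rewrite -!EFinM -EFinD addn1 exprS {1}gE; congr EFin.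
  by ring.
move: S0 E1 E2; case: S => [t| |] // _.
rewrite expr0 mul1r /convol big_ord_recl big_ord0 subn0 addr0.
rewrite -!EFinM -!EFinD => -[E1] [E2].
have : v * (p 0%N * g 0%N) + v * t = s * a.
  by rewrite -mulrDr E1; field; rewrite gt_eqF.
by rewrite E2 => /eqP; rewrite -subr_eq addrK => /eqP.
Qed.

End GeneratingFunction.

(** * The upward passage times *)

Section AscentTime.
Context {R : realType} (p : nat -> R) (hp : is_pmf p) (v : R) (hv : 0 < v < 1).

(** Contraction: if r <= s + e everywhere, then the equations give r <= s + v e off
    0. Starting from r <= s + 1 this yields r <= s + v^n for all n. Only one-sided
    bounds are iterated, so that all series have nonnegative terms. *)
Lemma dual_harmonic_le (r s : nat -> R) :
  (forall j, 0 <= r j <= 1) -> (forall j, 0 <= s j) -> r 0%N = s 0%N ->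
  (forall j, (r j.+1)%:E = v%:E * \sum_(0 <= k <oo) (p k)%:E * (r (j + k)%N)%:E)%E ->
  (forall j, (s j.+1)%:E = v%:E * \sum_(0 <= k <oo) (p k)%:E * (s (j + k)%N)%:E)%E ->
  forall j, r j <= s j.
Proof.
case: hp => p0 p1; case/andP: hv => v0 v1 r01 s0 rs0 rE sE.
have le n : forall j, r j <= s j + v ^+ n.
  elim: n => [|n IH] j.
    by case/andP: (r01 j) => _ r1; rewrite expr0 (le_trans r1) // lerDr.
  case: j => [|j]; first by rewrite rs0 lerDl exprn_ge0 // ltW.
  rewrite -lee_fin EFinD rE sE exprS EFinM -muleDr //; last first.
    by rewrite ge0_adde_def // inE ?lee_fin ?exprn_ge0 ?(ltW v0) // nneseries_ge0 //
       => k _ _; rewrite -EFinM lee_fin mulr_ge0.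
  apply: lee_wpmul2l; first by rewrite lee_fin ltW.
  have vn0 : 0 <= v ^+ n by rewrite exprn_ge0 // ltW.
  rewrite -[X in (_ <= _ + X)%E]mule1 -p1 -nneseriesZl; last by move=> k _; rewrite lee_fin.
  rewrite -nneseriesD; last 2 first.
  - by move=> k _ _; rewrite -EFinM lee_fin mulr_ge0.
  - by move=> k _ _; rewrite -EFinM lee_fin mulr_ge0.
  apply: lee_nneseries => [k _ _|k _].
    by rewrite -EFinM lee_fin mulr_ge0 //; case/andP: (r01 (j + k)%N).
  rewrite -!EFinM -EFinD lee_fin [v ^+ n * _]mulrC -mulrDr ler_wpM2l //.
move=> j; apply/ler_addgt0Pl => e e0.
have vX : GRing.exp v @ \oo --> 0 by apply: cvg_expr; rewrite gtr0_norm.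
have [n _ /(_ n (leqnn n))] := (cvgrPdist_lt _ _).1 vX e e0.
rewrite sub0r normrN /= ger0_norm ?exprn_ge0 ?(ltW v0) // => vne.
by apply: le_trans (le n j) _; rewrite addrC lerD2r ltW.
Qed.

(** The shift [h (j + 1)] and the multiple [h 1 * h j] solve the same equation with
    the same value at 0, hence coincide. *)
Lemma dual_harmonic_exp (h : nat -> R) :
  (forall j, 0 <= h j <= 1) -> h 0%N = 1 ->
  (forall j, (h j.+1)%:E = v%:E * \sum_(0 <= k <oo) (p k)%:E * (h (j + k)%N)%:E)%E ->
  forall j, h j = h 1%N ^+ j.
Proof.
move=> h01 h0 hE.
have hge j : 0 <= h j by case/andP: (h01 j).
have rE j : ((h j.+2)%:E = v%:E * \sum_(0 <= k <oo) (p k)%:E * (h (j + k).+1)%:E)%E.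
  exact: hE.
have sE j : ((h 1%N * h j.+1)%:E =
    v%:E * \sum_(0 <= k <oo) (p k)%:E * (h 1%N * h (j + k)%N)%:E)%E.
  rewrite EFinM (hE j) muleCA -nneseriesZl; last first.
    by move=> k _; rewrite -EFinM lee_fin mulr_ge0 // hp.1.
  by congr (_ * _)%E; apply: eq_eseriesr => k _; rewrite muleCA -EFinM.
have E j : h j.+1 = h 1%N * h j.
  apply/le_anti/andP; split.
    apply: (dual_harmonic_le (fun j => h j.+1) (fun j => h 1%N * h j)) => //.
      by move=> i; rewrite mulr_ge0.
    by rewrite h0 mulr1.
  apply: (dual_harmonic_le (fun j => h 1%N * h j) (fun j => h j.+1)) => //.
    move=> i; rewrite mulr_ge0 //= mulr_ile1 //; first by case/andP: (h01 1%N).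
    by case/andP: (h01 i).
  by rewrite h0 mulr1.
by elim=> [|j IH]; [rewrite h0|rewrite E exprS -IH].
Qed.

(** By homogeneity in space, h(j) = u(1 - j) is the transform of the time to climb
    j levels; as h(k) = phi^k, the equation for h(1) becomes phi = v sum_k p_k phi^k,
    from which phi <= v < 1. *)
Lemma ascent_exp (phi : R) (u : int -> \bar R) :
  u = exit_value p v (fun z => 1 <= z) pred0 -> phi = fine (u 0) ->
  0 <= phi < 1 /\ (\sum_(0 <= k <oo) (p k * phi ^+ k)%:E = (phi / v)%:E)%E.
Proof.
move=> uE phiE; pose h (j : nat) := fine (u (1 - j%:Z)).
have uK z : (fine (u z))%:E = u z by rewrite uE fine_exit_valueK.
have h01 j : 0 <= h j <= 1 by rewrite /h uE fine_exit_value_itv.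
have h0 : h 0%N = 1 by rewrite /h uE exit_value_target.
have hE j : ((h j.+1)%:E = v%:E * \sum_(0 <= k <oo) (p k)%:E * (h (j + k)%N)%:E)%E.
  rewrite /h uK uE exit_value_step //; last by rewrite -ltNge; lia.
  congr (_ * _)%E; apply: eq_eseriesr => k _; rewrite -uE uK; congr (_ * u _)%E.
  by lia.
have h1 : h 1%N = phi by rewrite /h subrr phiE.
have hX := dual_harmonic_exp h h01 h0 hE.
case/andP: (hv) => v0 v1.
have G : (phi%:E = v%:E * \sum_(0 <= k <oo) (p k * phi ^+ k)%:E)%E.
  rewrite -h1 hE; congr (_ * _)%E; apply: eq_eseriesr => k _.
  by rewrite add0n hX -EFinM.
have phi01 : 0 <= phi <= 1 by rewrite -h1.
case/andP: phi01 => phi0 phi1.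
have nn k : (0 <= (p k * phi ^+ k)%:E)%E by rewrite lee_fin mulr_ge0 ?exprn_ge0 ?hp.1.
move: G; set S := (\sum_(0 <= k <oo) _)%E => G.
have S1 : (S <= 1)%E.
  rewrite -hp.2; apply: lee_nneseries => // k _.
  by rewrite lee_fin ler_piMr ?hp.1 // exprn_ile1.
have S0 : (0 <= S)%E by apply: nneseries_ge0.
move: S0 S1 G; case: S => [t| |] //; rewrite !lee_fin -EFinM => t0 t1 [->].
split; last by congr EFin; field; rewrite gt_eqF.
by rewrite mulr_ge0 ?(ltW v0) //= (le_lt_trans _ v1) // ler_piMr // ltW.
Qed.

End AscentTime.

(** * Two-sided exit and ruin *)

Section Identities.
Context {R : realType} (p : nat -> R) (hp : is_pmf p) (v : R) (hv : 0 < v < 1).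

Let p0 : forall k, 0 <= p k. Proof. by case: hp. Qed.

(** E_x[v^tau_a^+; tau_a^+ < tau_(-1)^-]. *)
Definition up_value (a x : nat) : R :=
  fine (exit_value p v (fun z => a%:Z <= z) (fun z => z <= -1) x%:Z).

Lemma up_value_diag a : up_value a a = 1.
Proof. by rewrite /up_value exit_value_target. Qed.

Lemma up_value_convol a x : (x < a)%N ->
  up_value a x = v * convol p (up_value a) x.+1.
Proof.
move=> xa; rewrite /up_value exit_value_step -?ltNge //; try lia.
rewrite [X in fine (_ * X)%E](_ : _ = (convol p (up_value a) x.+1)%:E) //.
rewrite -(series_convol _ (exit_value p v (fun z => a%:Z <= z) (fun z => z <= -1))) //.
- by apply: eq_eseriesr => k _; congr (_ * exit_value _ _ _ _ _)%E; lia.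
- by move=> z; exact: exit_value_ge0.
- by move=> z z0; rewrite exit_value_killed //; lia.
- by move=> i; rewrite /up_value fine_exit_valueK.
Qed.

(** The complement 1 - E_x[v^tau_(-1)^-] of the transform of the ruin time. Unlike the
    transform itself it vanishes below 0, so its first-step sum is finite. *)
Definition survival_value (x : nat) : R :=
  1 - fine (exit_value p v (fun z => z <= -1) pred0 x%:Z).

Lemma survival_value_itv x : 0 <= survival_value x <= 1.
Proof.
have := fine_exit_value_itv p hp v hv (fun z => z <= -1) pred0 x%:Z.
by rewrite /survival_value => /andP[? ?]; apply/andP; split; lra.
Qed.

(** The mean over one step of 1 - f is 1 minus the mean of f, since [p] has mass 1. *)
Lemma survival_value_convol x :
  survival_value x = (1 - v) + v * convol p survival_value x.+1.
Proof.
set f := exit_value p v (fun z => z <= -1) pred0.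
have fK z : (fine (f z))%:E = f z by rewrite fine_exit_valueK.
have f01 z : 0 <= fine (f z) <= 1 by exact: fine_exit_value_itv.
pose G z : \bar R := (1 - fine (f z))%:E.
have G0 z : (0 <= G z)%E by rewrite lee_fin subr_ge0; case/andP: (f01 z).
have GE : (\sum_(0 <= k <oo) (p k)%:E * G (x.+1%:Z - k%:Z)%R =
    (convol p survival_value x.+1)%:E)%E.
  apply: series_convol => // z z0; rewrite /G /f exit_value_target ?subrr //; lia.
have fE : f x%:Z = (v%:E * \sum_(0 <= k <oo) (p k)%:E * f (x.+1%:Z - k%:Z)%R)%E.
  rewrite /f exit_value_step //.
  by congr (_ * _)%E; apply: eq_eseriesr => k _; congr (_ * exit_value _ _ _ _ _)%E; lia.
have sumE : (\sum_(0 <= k <oo) (p k)%:E * f (x.+1%:Z - k%:Z)%R +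
    \sum_(0 <= k <oo) (p k)%:E * G (x.+1%:Z - k%:Z)%R = 1)%E.
  rewrite -nneseriesD; last 2 first.
  - by move=> k _ _; rewrite mule_ge0 ?lee_fin //; exact: exit_value_ge0.
  - by move=> k _ _; apply: mule_ge0 => //; rewrite lee_fin.
  rewrite -hp.2; apply: eq_eseriesr => k _.
  by rewrite -fK /G -!EFinM -EFinD; congr EFin; ring.
rewrite {1}/survival_value -/f fE; move: sumE; rewrite GE.
move: (convol _ _ _) (\sum_(_ <= _ <oo) _)%E => c [t| |] //.
by rewrite -EFinD -EFinM /= => -[E]; have -> : c = 1 - t; [lra|ring].
Qed.

(** Both sides solve the inhomogeneous equation, so it is enough to compare them at
    0, where the constant is the one found in [survival_at0]. *)
Lemma survival_value_scale (s : R) (Wn : nat -> R) x :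
  p 0%N != 0 -> 0 <= s < 1 ->
  (\sum_(0 <= k <oo) (p k * s ^+ k)%:E = (s / v)%:E)%E ->
  Wn 0%N = (p 0%N)^-1 -> (forall y, Wn y = v * convol p Wn y.+1) ->
  survival_value x = (s * (1 - v)) / (v * (1 - s)) * Wn x
    - (v^-1 - 1) * \sum_(y < x) Wn y.
Proof.
move=> p0n s01 Gs W0 WE; set c := _ / _.
pose H y := c * Wn y + (- (v^-1 - 1)) * \sum_(z < y) Wn z.
have g0 := survival_at0 p survival_value s v p0 survival_value_itv s01 hv Gs
  survival_value_convol.
case/andP: s01 => s0 s1.
have vn : v != 0 by case/andP: hv => v0 _; rewrite gt_eqF.
have E : 1 * survival_value x + (-1) * H x = 0.
  apply: (convol_eq0 p v (fun x => 1 * survival_value x + (-1) * H x) x) => //.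
    rewrite /=; have -> : survival_value 0%N = (1 - v) * s / (1 - s) / (v * p 0%N).
      by rewrite -g0; field; rewrite p0n.
    rewrite /H big_ord0 W0 /c; field.
    by rewrite vn p0n subr_eq0 eq_sym lt_eqF.
  move=> y _; rewrite convol_linear /H convol_linear {1}survival_value_convol.
  rewrite {1}WE {1}(sum_convol p v) //; field; exact: vn.
have -> : survival_value x = H x by lra.
by rewrite /H mulNr.
Qed.

End Identities.

(** * The transform of the ruin time *)

Theorem mainTheorem4 (R : realType) (p : nat -> R)
    (d : measure_display) (T : measurableType d)
    (P : int -> probability T R) (X0 : T -> int) (C : nat -> {mfun T >-> nat})
    (hp : is_pmf p) (hp0 : 0 < p 0%N)
    (hX : walk_laws p P X0 C)
    (v : R) (hv : 0 < v < 1) (x : nat) :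
  discounted (P x%:Z) v (tau_down X0 C (- 1))
    [set w | (tau_down X0 C (- 1) w < +oo :> \bar R)%E] =
  (Z p P X0 C v x
   - (phi P X0 C v * (1 - v)) / (v * (1 - phi P X0 C v))
     * W p P X0 C v x%:Z)%:E.
Proof.
have [mX PX iid] := hX; have [p0 _] := hp; have /andP[v0 _] := hv.
have mC i k : measurable ((C i : T -> nat) @^-1` [set k]).
  exact: measurable_funPTI.
have value z (A B : pred int) : (forall y, A y -> ~~ B y) ->
    discounted (P z) v (hitting_time X0 (fun i => C i : T -> nat) A)
      [set w | (hitting_time X0 (fun i => C i : T -> nat) A w <
                hitting_time X0 (fun i => C i : T -> nat) B w :> \bar R)%E] =
    exit_value p v A B z.
  move=> AB.
  exact: (discounted_series _ _ _ _ _ _ _ _ mX mC p0 (iid z) (PX z) AB (ltW v0)).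
have never w : hitting_time X0 (fun i => C i : T -> nat) pred0 w = +oo%E :> \bar R.
  by have [[n []]|[_ ->]] := @hitting_timeP _ _ R X0 (fun i => C i : T -> nat) pred0 w.
have valueT z (A : pred int) :
    discounted (P z) v (hitting_time X0 (fun i => C i : T -> nat) A)
      [set w | (hitting_time X0 (fun i => C i : T -> nat) A w < +oo :> \bar R)%E] =
    exit_value p v A pred0 z.
  rewrite -value //; congr (discounted _ _ _ _).
  by apply/seteqP; split=> w /=; rewrite never.
have phiE : phi P X0 C v = fine (exit_value p v (fun z => 1 <= z) pred0 0).
  by rewrite -valueT.
have WE y : W p P X0 C v y%:Z = scale p (up_value p v) y.
  by rewrite /W /= /scale /up_value -value // => z; lia.
have [s01 Gs] := ascent_exp p hp v hv _ _ erefl phiE.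
have p0n : p 0%N != 0 by rewrite gt_eqF.
have vn : v != 0 by rewrite gt_eqF.
have U1 := up_value_diag p hp v hv.
have UE := up_value_convol p hp v hv.
have E := survival_value_scale p hp v hv _ _ x p0n s01 Gs (scale0 p _ U1)
  (scale_convol p v p0n vn _ U1 UE).
rewrite [LHS](valueT _ (fun z => z <= -1)) -(fine_exit_valueK p hp v hv).
congr EFin; rewrite /Z WE; under eq_bigr do rewrite WE.
by move: E; rewrite /survival_value => E; lra.
Qed.
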